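(* Let $A$ be an even, invertible linear operator on an $n|m$-dimensional superspace $V$, diagonal in a homogeneous basis $e_1,\dots,e_n$ (even), $e_{\hat 1},\dots,e_{\hat m}$ (odd) with even eigenvalues $x_1,\dots,x_n$ and $y_1,\dots,y_m$ respectively, where $|y_1|<\dots<|y_m|$. For any $s$ with $0<s<m$, the Laurent expansion of $\operatorname{Ber}(E+zA)$ in the annulus $$\frac{1}{|y_{m-s+1}|}<|z|<\frac1{|y_{m-s}|}$$ between two consecutive poles is given by $$\operatorname{Ber}(E+zA)=\sum_{N\in\mathbb Z}z^N(-1)^N\operatorname{Str}S^{N,s}(A^{\Pi})=\sum_{N\in\mathbb Z}z^N\operatorname{Str}\bigl(S^{N,s}(A^{\Pi})\bigr)^{\Pi^N}.$$ In particular, the coefficients in the right-hand side are the supertraces of the action of $A$ in the vector spaces $\Pi^NS^{N,s}(\Pi V)$.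
   Context: $V$ is an $n|m$-dimensional vector superspace (more precisely, a free module of rank $n|m$ over an auxiliary Grassmann algebra over $\mathbb C$); $E$ is the identity operator; $\operatorname{Ber}$ is the Berezinian, so for diagonal $A$, $\operatorname{Ber}(E+zA)=\prod_{a=1}^n(1+zx_a)\big/\prod_{\mu=1}^m(1+zy_\mu)$. Absolute values and inequalities for elements of the Grassmann algebra refer to their numerical parts. All $y_\mu$ and all differences $y_\mu-y_\nu$ ($\mu\ne\nu$) are invertible. $\Pi$ is parity reversion; $\varepsilon_A=\Pi e_A$ is the basis of $\Pi V$, with $\varepsilon_1,\dots,\varepsilon_n$ odd and $\varepsilon_{\hat 1},\dots,\varepsilon_{\hat m}$ even. $A^\Pi$ is the operator induced on $\Pi V$ (so $A^\Pi\varepsilon_a=x_a\varepsilon_a$, $A^\Pi\varepsilon_{\hat\mu}=y_\mu\varepsilon_{\hat\mu}$). More generally, for an operator $B$ on a superspace $W$, $B^{\Pi^N}$ is the operator induced on $\Pi^NW$; $\operatorname{Str}(B^\Pi)=-\operatorname{Str}B$. Formal delta-functions: for an even variable $t$, $\delta(t)$ is a formal symbol, odd, with $t\,\delta(t)=0$ and $\delta(at)=a^{-1}\delta(t)$ for any even invertible $a$; $\delta^{(j)}(t)$ are its formal derivatives (all odd), obeying the usual rules of differentiation, so $\delta^{(j)}(at)=a^{-1-j}\delta^{(j)}(t)$. Products of such symbols in distinct independent even variables are allowed. For $N\in\mathbb Z$ and $0<s<m$, $S^{N,s}(\Pi V)$ is the vector space with basis the products $$(\varepsilon_1)^{k_1}\cdots(\varepsilon_n)^{k_n}(\varepsilon_{\hat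 1})^{i_1}\cdots(\varepsilon_{\widehat{m-s}})^{i_{m-s}}\,\delta^{(j_{m-s+1})}(\varepsilon_{\widehat{m-s+1}})\cdots\delta^{(j_m)}(\varepsilon_{\hat m}),$$ where $k_a\in\{0,1\}$, $i_\mu,j_\nu\in\mathbb Z_{\ge0}$ and $$k_1+\dots+k_n+i_1+\dots+i_{m-s}-s-j_{m-s+1}-\dots-j_m=N.$$ The parity of this basis vector is $k_1+\dots+k_n+s\bmod 2$. The operator $S^{N,s}(A^\Pi)$ on $S^{N,s}(\Pi V)$ is induced by the action of $A^\Pi$ on the $\varepsilon$'s: the basis vector $(\varepsilon_1)^{k_1}\cdots(\varepsilon_n)^{k_n}(\varepsilon_{\hat 1})^{i_1}\cdots(\varepsilon_{\widehat{m-s}})^{i_{m-s}}\,\delta^{(j_{m-s+1})}(\varepsilon_{\widehat{m-s+1}})\cdots\delta^{(j_m)}(\varepsilon_{\hat m})$ is an eigenvector with eigenvalue $$x_1^{k_1}\cdots x_n^{k_n}\,y_1^{i_1}\cdots y_{m-s}^{i_{m-s}}\,y_{m-s+1}^{-1-j_{m-s+1}}\cdots y_m^{-1-j_m}.$$ The supertrace $\operatorname{Str}$ of this diagonal operator is the (in general infinite) sum over basis vectors of the eigenvalues, taken with sign $+$ for even and $-$ for odd basis vectors. *)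

(* Defs.v *)
From HB Require Import structures.
From mathcomp Require Import all_boot all_order all_algebra.
From mathcomp Require Import boolp.

Set Implicit Arguments.
Unset Strict Implicit.
Unset Printing Implicit Defensive.

Import Order.TTheory GRing.Theory Num.Theory.
Local Open Scope ring_scope.

(* The Grassmann algebra over K on q anticommuting generators theta_i: the
   element f is the sum over S of f S *: theta_S, where theta_S is the product
   of the theta_i for i in S, taken in increasing order. *)
Definition grassmann (K : comNzRingType) (q : nat) : Type :=
  {ffun {set 'I_q} -> K}.

HB.instance Definition _ (K : comNzRingType) q :=
  GRing.Zmodule.copy (grassmann K q) {ffun {set 'I_q} -> K}.

Section GrassmannRing.
Variables (K : comNzRingType) (q : nat).
Implicit Types (S T U P : {set 'I_q}) (f g h : grassmann K q).

(* theta_T * theta_U = (-1) ^+ inversions T U *: theta_(T :|: U) for disjoint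
   T and U. *)
Definition inversions T U : nat :=
  #|[set p : 'I_q * 'I_q | [&& p.1 \in T, p.2 \in U & (p.2 < p.1)%N]]|.

Definition gmul f g : grassmann K q :=
  [ffun S : {set 'I_q} => \sum_(T : {set 'I_q} | T \subset S)
     (-1) ^+ inversions T (S :\: T) * (f T * g (S :\: T))].

Definition gone : grassmann K q := [ffun S : {set 'I_q} => (S == set0)%:R].

Lemma inversionsUl T U P : [disjoint T & U] ->
  inversions (T :|: U) P = (inversions T P + inversions U P)%N.
Proof.
move=> dTU; rewrite /inversions -cardsUI.
rewrite (_ : _ :&: _ = set0) ?cards0 ?addn0; last first.
  apply/setP => -[i j]; rewrite !inE /=; apply/negP.
  move=> /andP[/and3P[iT _ _] /and3P[iU _ _]].
  by have := disjointFr dTU iT; rewrite iU.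
apply: eq_card => -[i j]; rewrite !inE /=.
by case: (i \in T); case: (i \in U); rewrite ?orbF ?orbb.
Qed.

Lemma inversionsUr T U P : [disjoint U & P] ->
  inversions T (U :|: P) = (inversions T U + inversions T P)%N.
Proof.
move=> dUP; rewrite /inversions -cardsUI.
rewrite (_ : _ :&: _ = set0) ?cards0 ?addn0; last first.
  apply/setP => -[i j]; rewrite !inE /=; apply/negP.
  move=> /andP[/and3P[_ jU _] /and3P[_ jP _]].
  by have := disjointFr dUP jU; rewrite jP.
apply: eq_card => -[i j]; rewrite !inE /=.
by case: (i \in T); case: (j \in U); case: (j \in P); rewrite ?orbF ?orbb.
Qed.

Lemma inversions0l U : inversions set0 U = 0%N.
Proof. by apply: eq_card0 => -[i j]; rewrite !inE. Qed.

Lemma inversions0r T : inversions T set0 = 0%N.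
Proof. by apply: eq_card0 => -[i j]; rewrite !inE /= andbF. Qed.

Lemma gmulA : associative gmul.
Proof.
move=> f g h; apply/ffunP => S; rewrite !ffunE.
transitivity (\sum_(T : {set 'I_q} | T \subset S)
    \sum_(P : {set 'I_q} | (T \subset P) && (P \subset S))
    (-1) ^+ (inversions T (P :\: T) + inversions T (S :\: P)
       + inversions (P :\: T) (S :\: P))
       * (f T * g (P :\: T) * h (S :\: P))).
  apply: eq_bigr => T TS; rewrite ffunE !mulr_sumr.
  rewrite (reindex_onto (fun P : {set 'I_q} => P :\: T)
    (fun U => T :|: U)) /=; last first.
    move=> U US; apply/setP => i; rewrite !inE.
    by case: (boolP (i \in T)) => //= iT; have := subsetP US i; rewrite !inE iT;
       case: (i \in U) => // /(_ isT).
  apply: eq_big => P.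
    apply/andP/andP => [[PS /eqP <-]|[TP PS]].
      split; first exact: subsetUl.
      rewrite subUset TS; apply: (subset_trans PS); exact: subsetDl.
    split; first exact: setSD.
    by apply/eqP/setP => i; rewrite !inE; have := subsetP TP i;
       case: (i \in T) => //= /(_ isT) ->.
  move=> /andP[PS /eqP TPE].
  have TP : T \subset P by rewrite -TPE subsetUl.
  have PS' : P \subset S.
    by rewrite -TPE subUset TS; apply: (subset_trans PS); exact: subsetDl.
  have -> : (S :\: T) :\: (P :\: T) = S :\: P.
    apply/setP => i; rewrite !inE; have := subsetP TP i.
    by case: (i \in T) => /= [->|]; rewrite ?andbF ?andbT.
  have -> : S :\: T = (P :\: T) :|: (S :\: P).
    apply/setP => i; rewrite !inE; have := subsetP TP i; have := subsetP PS' i.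
    by case: (i \in T); case: (i \in P); case: (i \in S) => //=;
      do ?[by move=> /(_ isT)|by move=> _ /(_ isT)].
  rewrite inversionsUr; last first.
    rewrite -setI_eq0; apply/eqP/setP => i; rewrite !inE.
    by case: (i \in P); rewrite ?andbF.
  rewrite !exprD; set a := (-1) ^+ _; set b := (-1) ^+ _; set c := (-1) ^+ _.
  by rewrite [f T * _]mulrCA !mulrA.
rewrite (exchange_big_dep (fun P : {set 'I_q} => P \subset S)) /=; last first.
  by move=> T P _ /andP[].
apply: eq_bigr => P PS; rewrite ffunE mulr_suml mulr_sumr.
apply: eq_big => T.
  by rewrite PS andbT andb_idl // => TP; exact: subset_trans PS.
move=> /andP[_ /andP[TP _]].
have PE : P = T :|: (P :\: T).
  by apply/setP => i; rewrite !inE; have := subsetP TP i;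
       case: (i \in T) => //= /(_ isT) ->.
rewrite [in inversions P _]PE inversionsUl; last first.
  rewrite -setI_eq0; apply/eqP/setP => i; rewrite !inE.
  by case: (i \in T); rewrite ?andbF.
rewrite !exprD; set a := (-1) ^+ _; set b := (-1) ^+ _; set c := (-1) ^+ _.
by rewrite -PE -/b -/c -(mulrA a b) [a * _]mulrC -!mulrA.
Qed.

Lemma gmul1f : left_id gone gmul.
Proof.
move=> f; apply/ffunP => S; rewrite ffunE (bigD1 set0) ?sub0set //=.
rewrite big1 => [|T /andP[_ /negPf T0]]; last by rewrite ffunE T0 mul0r mulr0.
by rewrite setD0 ffunE eqxx inversions0l !mul1r addr0.
Qed.

Lemma gmulf1 : right_id gone gmul.
Proof.
move=> f; apply/ffunP => S; rewrite ffunE (bigD1 S) //=.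
rewrite big1 => [|T /andP[TS nTS]]; last first.
  rewrite [gone _]ffunE setD_eq0 [S \subset T]negbTE ?mulr0 //.
  by apply: contra nTS => ST; rewrite eqEsubset TS.
by rewrite setDv ffunE eqxx inversions0r mulr1 mul1r addr0.
Qed.

Lemma gmulDl : left_distributive gmul +%R.
Proof.
move=> f g h; apply/ffunP => S; rewrite !ffunE -big_split /=.
by apply: eq_bigr => T _; rewrite ffunE mulrDl mulrDr.
Qed.

Lemma gmulDr : right_distributive gmul +%R.
Proof.
move=> f g h; apply/ffunP => S; rewrite !ffunE -big_split /=.
by apply: eq_bigr => T _; rewrite ffunE !mulrDr.
Qed.

Lemma gone_neq0 : gone != 0.
Proof.
apply/eqP => /ffunP/(_ set0)/eqP.
by rewrite !ffunE eqxx oner_eq0.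
Qed.

HB.instance Definition _ := GRing.Zmodule_isNzRing.Build (grassmann K q)
  gmulA gmul1f gmulf1 gmulDl gmulDr gone_neq0.

Let ginvertible f := exists g, g * f = 1 /\ f * g = 1.

Definition gunit f : bool := `[< ginvertible f >].

Definition ginv f : grassmann K q :=
  if pselect (ginvertible f) is left fV then projT1 (cid fV) else f.

Let ginvP f : gunit f -> ginv f * f = 1 /\ f * ginv f = 1.
Proof.
move=> /asboolP fV; rewrite /ginv.
by case: pselect => // fV'; exact: (projT2 (cid fV')).
Qed.

Lemma gmulVf : {in gunit, left_inverse 1 ginv *%R}.
Proof. by move=> f /ginvP[]. Qed.

Lemma gmulfV : {in gunit, right_inverse 1 ginv *%R}.
Proof. by move=> f /ginvP[]. Qed.

Lemma gunitP f g : g * f = 1 /\ f * g = 1 -> gunit f.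
Proof. by move=> fg; apply/asboolP; exists g. Qed.

Lemma ginv_out : {in [predC gunit], ginv =1 id}.
Proof.
move=> f; rewrite inE /= => /negP fU; rewrite /ginv.
by case: pselect => // fV; case: fU; apply/asboolP.
Qed.

HB.instance Definition _ := GRing.NzRing_hasMulInverse.Build (grassmann K q)
  gmulVf gmulfV gunitP ginv_out.

Definition body f : K := f set0.

Definition gparity (p : bool) f : bool :=
  [forall S : {set 'I_q}, (f S != 0) ==> (odd #|S| == p)].

End GrassmannRing.

Notation geven := (gparity false).

From mathcomp Require Import complex.
From mathcomp Require Import all_classical all_reals all_analysis.
From mathcomp Require Import summability.
Import numFieldNormedType.Exports.
Local Open Scope classical_set_scope.
Local Open Scope complex_scope.
Local Open Scope ring_scope.

Record superspace := Superspace {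
  hbasis : choiceType;
  hparity : hbasis -> bool   (* true for the odd basis vectors *)
}.

(* Pi^N W, with basis Pi^N e_b; since Pi is an involution only the parity of N
   matters. *)
Definition Pin (N : int) (W : superspace) : superspace :=
  @Superspace (hbasis W) (fun b => hparity b (+) odd `|N|%N).

Notation Pi := (Pin 1).

Definition std_superspace (n m : nat) : superspace :=
  @Superspace ('I_n + 'I_m)%type (fun b => if b is inl _ then false else true).

Section Vectors.
Variables (K : comNzRingType) (q : nat) (W : superspace).
Local Notation Lam := (grassmann K q).

Definition fin_supp : {pred hbasis W -> Lam} :=
  fun v => `[< finite_set [set b | v b != 0] >].

Lemma fin_supp_zmod_closed : zmod_closed fin_supp.
Proof.
split=> [|u v /asboolP fu /asboolP fv]; apply/asboolP.
  by apply: (sub_finite_set _ (@finite_set0 _)) => b /=; rewrite eqxx.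
have fuv : finite_set ([set b | u b != 0] `|` [set b | v b != 0]).
  by rewrite finite_setU.
apply: (sub_finite_set _ fuv) => b /= uvb.
apply/orP; apply: contraNT uvb.
by rewrite negb_or !negbK /= => /andP[/eqP ub /eqP vb];
   apply/eqP; rewrite !fctE ub vb subr0.
Qed.

HB.instance Definition _ :=
  GRing.isZmodClosed.Build (hbasis W -> Lam) fin_supp fin_supp_zmod_closed.

(* The free supermodule on the homogeneous basis of W: v stands for the finite
   sum of the e_b * v b, with coefficients on the right. *)
Record vec := Vec { coord :> hbasis W -> Lam; coordP : coord \in fin_supp }.

HB.instance Definition _ := [isSub for coord].
HB.instance Definition _ := [Choice of vec by <:].
HB.instance Definition _ := [SubChoice_isSubZmodule of vec by <:].

Lemma vec_rscale_subproof (a : Lam) (v : vec) :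
  (fun b => v b * a) \in fin_supp.
Proof.
apply/asboolP/(sub_finite_set _ (asboolP _ (coordP v))) => b /=.
by apply: contraNN => /eqP ->; rewrite mul0r.
Qed.

Definition vec_rscale (a : Lam^c) (v : vec) : vec :=
  Vec (vec_rscale_subproof a v).

Lemma vec_rscaleA a b v :
  vec_rscale a (vec_rscale b v) = vec_rscale (a * b) v.
Proof. by apply/val_inj/funext => c; rewrite /= -mulrA. Qed.

Lemma vec_rscale1 : left_id 1 vec_rscale.
Proof. by move=> v; apply/val_inj/funext => b; rewrite /= mulr1. Qed.

Lemma vec_rscaleDr : right_distributive vec_rscale +%R.
Proof. by move=> a u v; apply/val_inj/funext => b; rewrite /= -mulrDl. Qed.

Lemma vec_rscaleDl v : {morph vec_rscale^~ v : a b / a + b}.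
Proof. by move=> a b; apply/val_inj/funext => c; rewrite /= -mulrDr. Qed.

(* A right Lam-module, i.e. a left module over the converse ring: for a : Lam^c,
   a *: v is the vector v * a. *)
HB.instance Definition _ := GRing.Zmodule_isLmodule.Build Lam^c vec
  vec_rscaleA vec_rscale1 vec_rscaleDr vec_rscaleDl.

Lemma bvec_subproof (b : hbasis W) :
  (fun c => (c == b)%:R : Lam) \in fin_supp.
Proof.
apply/asboolP/(sub_finite_set _ (finite_set1 b)) => c /=.
by apply: contraNP => /eqP/negPf ->.
Qed.

Definition bvec (b : hbasis W) : vec := Vec (bvec_subproof b).

Definition homogeneous (p : bool) (v : vec) : Prop :=
  forall b, gparity (p (+) hparity b) (v b).

Definition even_operator (B : vec -> vec) : Prop :=
  forall p v, homogeneous p v -> homogeneous p (B v).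

End Vectors.

Arguments fin_supp : clear implicits.
Arguments bvec K q {W} b.

Section ParityShift.
Variables (K : comNzRingType) (q : nat) (W : superspace) (N : int).

(* The map v |-> Pi^N v, which is right linear: it keeps right coordinates. *)
Definition Pin_vec (v : vec K q W) : vec K q (Pin N W) :=
  @Vec K q (Pin N W) (coord v) (coordP v).

Definition unPin_vec (v : vec K q (Pin N W)) : vec K q W :=
  @Vec K q W (coord v) (coordP v).

Definition Pin_op (B : vec K q W -> vec K q W)
    (v : vec K q (Pin N W)) : vec K q (Pin N W) :=
  Pin_vec (B (unPin_vec v)).

End ParityShift.

Arguments Pin_vec {K q W} N v.
Arguments Pin_op {K q W} N B v.

Notation Pi_op B := (Pin_op 1 B).

Section Berezinian.
Variables (K : comNzRingType) (q n m : nat).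
Local Notation V := (std_superspace n m).

Definition even_bvec (a : 'I_n) : vec K q V := bvec K q (inl a : hbasis V).
Definition odd_bvec (mu : 'I_m) : vec K q V := bvec K q (inr mu : hbasis V).

(* Ber (B00 B01 // B10 B11) = \det (B00 - B01 B11^-1 B10) / \det B11 for an even
   operator such that B11 is invertible. The entries of B00 and B11 are even,
   hence commute, and B11^-1 is given by the adjugate as in invmx (which asks
   for a commutative ring of coefficients). *)
Definition Ber (B : vec K q V -> vec K q V) : grassmann K q :=
  let B00 := \matrix_(i < n, j < n) B (even_bvec j) (inl i) in
  let B01 := \matrix_(i < n, j < m) B (odd_bvec j) (inl i) in
  let B10 := \matrix_(i < m, j < n) B (even_bvec j) (inr i) in
  let B11 := \matrix_(i < m, j < m) B (odd_bvec j) (inr i) in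
  let B11V := (\det B11)^-1 *: \adj B11 in
  \det (B00 - B01 *m B11V *m B10) * (\det B11)^-1.

End Berezinian.

Arguments even_bvec K q {n} m a.
Arguments odd_bvec K q n {m} mu.

(* (k, l) encodes the product
     \prod_a eps_a ^ (k a) * \prod_(mu < m - s) eps_mu^ ^ (l mu)
       * \prod_(m - s <= mu < m) delta^(l mu) (eps_mu^)
   with mu counted from 0. *)
Definition monomial (n m : nat) : choiceType :=
  ({ffun 'I_n -> bool} * {ffun 'I_m -> nat})%type.

Definition mdegree (n m s : nat) (b : monomial n m) : int :=
  (\sum_(a < n) (b.1 a : nat))%N%:Z
  + (\sum_(mu < m | (mu < m - s)%N) b.2 mu)%N%:Z
  - s%:Z
  - (\sum_(mu < m | (m - s <= mu)%N) b.2 mu)%N%:Z.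

Definition mparity (n m s : nat) (b : monomial n m) : bool :=
  odd (\sum_(a < n) (b.1 a : nat) + s)%N.

(* S^{N,s}(Pi V), where V = std_superspace n m. *)
Definition S_superspace (n m : nat) (N : int) (s : nat) : superspace :=
  @Superspace {b : monomial n m | mdegree s b == N}
    (fun b => mparity s (val b)).

Section SOperator.
Variables (K : comNzRingType) (q n m : nat) (N : int) (s : nat).
Local Notation PiV := (Pi (std_superspace n m)).
Variable B : vec K q PiV -> vec K q PiV.

Definition diag_coef (i : hbasis PiV) : grassmann K q := B (bvec K q i) i.

(* eps_a ^ k is multiplied by x_a ^ k, eps_mu^ ^ l by y_mu ^ l, and
   delta^(l) (eps_mu^) by y_mu ^ (-1 - l). *)
Definition S_eigenvalue (b : hbasis (S_superspace n m N s)) : grassmann K q :=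
  (\prod_(a < n) diag_coef (inl a) ^+ (val b).1 a)
  * (\prod_(mu < m | (mu < m - s)%N) diag_coef (inr mu) ^+ (val b).2 mu)
  * (\prod_(mu < m | (m - s <= mu)%N) diag_coef (inr mu) ^- ((val b).2 mu).+1).

Lemma S_op_subproof (v : vec K q (S_superspace n m N s)) :
  (fun b => S_eigenvalue b * v b) \in fin_supp K q (S_superspace n m N s).
Proof.
apply/asboolP/(sub_finite_set _ (asboolP _ (coordP v))) => b /=.
by apply: contraNN => /eqP ->; rewrite mulr0.
Qed.

(* The operator S^{N,s}(B), for B diagonal in the basis eps of Pi V. *)
Definition S_op (v : vec K q (S_superspace n m N s)) :
  vec K q (S_superspace n m N s) := Vec (S_op_subproof v).

End SOperator.

Arguments S_op {K q n m} N s B v.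

Section Sums.
Variables (R : realType) (q : nat).
Local Notation Lam := (grassmann R[i] q).

(* Unconditional summation (limit over the finite subsets of the index type),
   coefficient by coefficient in the Grassmann algebra. *)
Definition gpartial_sums (I : choiceType) (f : I -> Lam) (S : {set 'I_q}) :
  set_system R[i]^o := partial_sum (fun i => f i S : R[i]^o) @ totally.

Definition ghas_sum (I : choiceType) (f : I -> Lam) (l : Lam) : Prop :=
  forall S, gpartial_sums f S --> (l S : R[i]^o).

Definition gsummable (I : choiceType) (f : I -> Lam) : Prop :=
  forall S, cvg (gpartial_sums f S).

Definition gsum (I : choiceType) (f : I -> Lam) : Lam :=
  [ffun S : {set 'I_q} => lim (gpartial_sums f S)].

Variable W : superspace.

Definition str_term (B : vec R[i] q W -> vec R[i] q W) (b : hbasis W) : Lam :=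
  (-1) ^+ hparity b * B (bvec R[i] q b) b.

Definition Str (B : vec R[i] q W -> vec R[i] q W) : Lam := gsum (str_term B).

End Sums.

(* Main.v *)
Require Import Defs.
From HB Require Import structures.
From mathcomp Require Import all_boot all_order all_algebra fingroup perm.
From mathcomp Require Import complex.
From mathcomp Require Import all_classical all_reals all_analysis.
From mathcomp Require Import summability fintype finset finmap ring.

Set Implicit Arguments.
Unset Strict Implicit.
Unset Printing Implicit Defensive.

Import Order.TTheory GRing.Theory Num.Theory.
Import numFieldNormedType.Exports ComplexField.Normc.
Local Open Scope complex_scope.
Local Open Scope ring_scope.

(** The coefficient of the expansion attached to a monomial with exponents [k]
    (odd generators) and [l] (even generators and orders of the delta
    functions) carries the sign [(-1)^(deg + parity)], where
    [deg = |k| + |l_lo| - s - |l_hi|] and the parity is [|k| + s].  The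
    contributions of [k] and [s] to the sign cancel, and what remains factors:
    up to the constant [\prod_hi (z y_mu)^-1], the term [z^deg * (...)] is
    [\prod_a (z x_a)^(k_a) * \prod_mu w_mu^(l_mu)] with [w_mu = - z y_mu] for
    [mu] below the annulus and [w_mu = - (z y_mu)^-1] above it
    ([monomial_term]).  So the sum over all monomials is a finite product of
    geometric series, whose value is
    [\prod_a (1 + z x_a) / \prod_mu (1 + z y_mu)]
    ([prefactor_mul_geometric]), the Berezinian of [E + zA]
    ([Ber_diagonal]).  Sorting the monomials by degree turns it into the sum
    over [N] of the supertraces ([ghas_sum_fibres]).

    Two features of the Grassmann algebra have to be dealt with.  Even elements
    are central ([geven_central]), so the algebra above takes place in the
    centre, a commutative ring.  For convergence, the norms
    [gnorm t f = \sum_S |f_S| t^|S|] are submultiplicative ([gnormM]) and tend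
    to the absolute value of the body as [t] tends to 0; hence an element whose
    body is less than 1 in absolute value has norm less than 1 for a suitable
    weight [t] ([exists_weight]), and the usual estimates for geometric series
    apply although nilpotent parts may be large.

    The supertraces do not depend on [z], so they converge as soon as the whole
    expansion converges absolutely for one [z]; a real number in the annulus
    will do. *)

(** * The centre of a ring *)

Section Centre.
Variable G : unitRingType.

Definition central : {pred G} := fun f => `[< forall g, GRing.comm f g >].

Lemma centralP f : reflect (forall g, GRing.comm f g) (f \in central).
Proof. exact: asboolP. Qed.

Lemma central_divring_closed : divring_closed central.
Proof.
split=> [|f g /centralP fC /centralP gC|f g /centralP fC /centralP gC];
    apply/centralP => h.
- exact/commr_sym/commr1.
- by apply/commr_sym/commrB; apply: commr_sym.
- apply/commr_sym/commrM; first exact: commr_sym.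
  exact/commrV/commr_sym.
Qed.

HB.instance Definition _ :=
  GRing.isDivringClosed.Build G central central_divring_closed.

Record centre := Centre { cval : G; cvalP : cval \in central }.

HB.instance Definition _ := [isSub for cval].
HB.instance Definition _ := [Choice of centre by <:].
HB.instance Definition _ := [SubChoice_isSubUnitRing of centre by <:].

Lemma centre_mulC : commutative (@GRing.mul centre).
Proof. by move=> [f fC] [g gC]; apply/val_inj/(centralP _ fC). Qed.

HB.instance Definition _ :=
  GRing.PzRing_hasCommutativeMul.Build centre centre_mulC.

Lemma val_unit (u : centre) :
  (val u \is a GRing.unit) = (u \is a GRing.unit).
Proof. by []. Qed.

End Centre.

(** * The Grassmann algebra *)

Section GrassmannAlgebra.
Variables (K : comUnitRingType) (q : nat).
Local Notation Lam := (grassmann K q).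
Implicit Types (S T U : {set 'I_q}) (f g : Lam).

Lemma gcoefM f g S : (f * g) S = \sum_(T : {set 'I_q} | T \subset S)
  (-1) ^+ inversions T (S :\: T) * (f T * g (S :\: T)).
Proof. by rewrite ffunE. Qed.

Lemma gcoef1 S : (1 : Lam) S = (S == set0)%:R.
Proof. by rewrite ffunE. Qed.

Lemma gcoefD f g S : (f + g) S = f S + g S.
Proof. by rewrite ffunE. Qed.

Lemma gcoefN f S : (- f) S = - f S.
Proof. by rewrite ffunE. Qed.

Lemma gcoef_sum (J : Type) (r : seq J) (P : pred J) (F : J -> Lam) S :
  (\sum_(i <- r | P i) F i) S = \sum_(i <- r | P i) F i S.
Proof. by elim/big_rec2: _ => [|i x y _ <-]; rewrite ?gcoefD // ffunE. Qed.

Lemma inversionsE T U :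
  inversions T U = (\sum_(i in T) \sum_(j in U) (j < i))%N.
Proof.
rewrite /inversions -sum1_card pair_big_dep /= big_mkcond [RHS]big_mkcond /=.
apply: eq_bigr => -[i j] _; rewrite inE /=.
by case: (i \in T); case: (j \in U) => //=; case: ltnP.
Qed.

(** Each pair in [T * U] is an inversion for exactly one of the two orders; so
    when [T] has even cardinality, the signs of [theta_T * theta_U] and
    [theta_U * theta_T] agree. *)
Lemma inversionsC T U : [disjoint T & U] ->
  (inversions T U + inversions U T)%N = (#|T| * #|U|)%N.
Proof.
move=> dTU; rewrite !inversionsE [X in (_ + X)%N]exchange_big -big_split /=.
rewrite -sum_nat_const; apply: eq_bigr => i iT.
rewrite -big_split /= -sum1_card; apply: eq_bigr => j jU.
case: (ltngtP j i) => // ij.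
by have := disjointFr dTU iT; rewrite -(val_inj ij) jU.
Qed.

Lemma geven_central f : geven f -> f \in @central Lam.
Proof.
move=> /forallP f_even; apply/centralP => g; apply/ffunP => S.
rewrite !gcoefM (reindex_onto (fun T => S :\: T) (fun T => S :\: T)) /=;
    last first.
  by move=> T TS; rewrite setDDr setDv set0U; apply/setIidPr.
apply: eq_big => T.
  rewrite subDset subsetUr setDDr setDv set0U /=.
  by apply/eqP/idP => [/setIidPr|/setIidPr].
move=> /andP[_ /eqP->]; rewrite [f _ * _]mulrC.
have [->|fST] := eqVneq (f (S :\: T)) 0; first by rewrite !mulr0.
congr (_ * _); rewrite -signr_odd -[RHS]signr_odd; congr (_ ^+ _).
congr nat_of_bool.
have : odd (inversions (S :\: T) T + inversions T (S :\: T)) = false.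
  rewrite inversionsC; last first.
    by rewrite -setI_eq0 setIDAC -setIDA setDv setI0.
  by rewrite oddM; have /implyP/(_ fST)/eqP -> := f_even (S :\: T).
by rewrite oddD; case: odd; case: odd.
Qed.

Lemma bodyM f g : body (f * g) = body f * body g.
Proof.
rewrite /body gcoefM (big_pred1 set0) => [|T]; last by rewrite /= subset0.
by rewrite setD0 inversions0l mul1r.
Qed.

Lemma body1 : body (1 : Lam) = 1.
Proof. by rewrite /body gcoef1 eqxx. Qed.

Lemma bodyN f : body (- f) = - body f.
Proof. exact: gcoefN. Qed.

Lemma bodyD f g : body (f + g) = body f + body g.
Proof. exact: gcoefD. Qed.

(** Membership in the [k]-th power of the augmentation ideal. *)
Definition gorder_ge k f := forall T, (#|T| < k)%N -> f T = 0.

Lemma gorder_geM j k f g :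
  gorder_ge j f -> gorder_ge k g -> gorder_ge (j + k) (f * g).
Proof.
move=> fj gk S Sjk; rewrite gcoefM big1 // => T TS.
have [Tj|jT] := ltnP #|T| j; first by rewrite fj // mul0r mulr0.
rewrite [g _]gk ?mulr0 // cardsD (setIidPr TS).
by rewrite ltn_subLR ?subset_leq_card // (leq_trans Sjk) // leq_add2r.
Qed.

Lemma body0_nilpotent f : body f = 0 -> f ^+ q.+1 = 0.
Proof.
move=> f0; have fk k : gorder_ge k (f ^+ k).
  elim: k => [//|k fk]; rewrite exprS -add1n; apply: gorder_geM => // T.
  by rewrite ltnS leqn0 cards_eq0 => /eqP ->.
apply/ffunP => S; rewrite [RHS]ffunE fk // ltnS.
by rewrite (leq_trans (max_card _)) ?card_ord.
Qed.

Definition gscalar (c : K) : Lam := [ffun S => if S == set0 then c else 0].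

Lemma gscalarM c d : gscalar (c * d) = gscalar c * gscalar d.
Proof.
apply/ffunP => S; rewrite gcoefM (bigD1 set0) ?sub0set //= big1 ?addr0.
  by rewrite setD0 inversions0l !ffunE eqxx mul1r; case: ifP; rewrite ?mulr0.
by move=> T /andP[_ /negPf T0]; rewrite ffunE T0 mul0r mulr0.
Qed.

Lemma gscalar1 : gscalar 1 = 1.
Proof. by apply/ffunP => S; rewrite !ffunE; case: eqP. Qed.

Lemma gscalar_body c : body (gscalar c) = c.
Proof. by rewrite /body ffunE eqxx. Qed.

Lemma gscalar_even c : geven (gscalar c).
Proof.
apply/forallP => S; rewrite ffunE.
have [->|_] := eqVneq S set0; last by rewrite eqxx.
by rewrite cards0 implybT.
Qed.

(** After division by the body, the element is [1 - w] with [w] nilpotent, and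
    is inverted by the finite geometric sum of the powers of [w]. *)
Lemma gunit_body f : body f \is a GRing.unit -> f \is a GRing.unit.
Proof.
move=> fU; pose c := gscalar (body f)^-1.
have cU : c \is a GRing.unit.
  apply/unitrP; exists (gscalar (body f)).
  by rewrite -!gscalarM divrr ?mulVr // gscalar1.
suff : c * f \is a GRing.unit by rewrite unitrMr.
have /body0_nilpotent : body (1 - c * f) = 0.
  by rewrite bodyD bodyN bodyM gscalar_body mulVr // body1 subrr.
move: (subKr 1 (c * f)); move: (1 - c * f) => w <- w0.
apply/unitrP; exists (\sum_(i < q.+1) w ^+ i).
have wC i : GRing.comm w (w ^+ i) by apply: commrX.
have geomE : (1 - w) * (\sum_(i < q.+1) w ^+ i) = 1.
  by rewrite -opprB mulNr -subrX1 w0 sub0r opprK.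
split=> //; rewrite -[RHS]geomE; apply/commr_sym/commr_sum => i _.
by apply/commr_sym/commrB; [exact: commr1|apply/commr_sym; exact: wC].
Qed.

End GrassmannAlgebra.

(** * Weighted norms *)

Section WeightedNorm.
Variables (R : realType) (q : nat).
Local Notation Lam := (grassmann R[i] q).
Implicit Types (S T U : {set 'I_q}) (f g w : Lam) (t : R).

Definition gnorm t f : R := \sum_(S : {set 'I_q}) normc (f S) * t ^+ #|S|.

Lemma normc_ge0 (c : R[i]) : 0 <= normc c.
Proof. by case: c => a b; apply: sqrtr_ge0. Qed.

Lemma norm_normc (c : R[i]) : `|c| = (normc c)%:C.
Proof. by []. Qed.

Lemma normc_sum (I : Type) (r : seq I) (P : pred I) (F : I -> R[i]) :
  normc (\sum_(i <- r | P i) F i) <= \sum_(i <- r | P i) normc (F i).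
Proof.
elim/big_rec2: _ => [|i x y _ yx]; first by rewrite normc0.
by rewrite (le_trans (le_normcD _ _)) // lerD2l.
Qed.

Lemma normc_sign (k : nat) : normc ((-1) ^+ k : R[i]) = 1.
Proof.
by elim: k => [|k IH]; rewrite ?normc1 // exprS normcM normcN normc1 mul1r.
Qed.

Section FixedWeight.
Variables (t : R) (t_gt0 : 0 < t).

Lemma gnorm_term_ge0 f S : 0 <= normc (f S) * t ^+ #|S|.
Proof. by rewrite mulr_ge0 ?normc_ge0 // exprn_ge0 // ltW. Qed.

Lemma gnorm_ge0 f : 0 <= gnorm t f.
Proof. by apply: sumr_ge0 => S _; apply: gnorm_term_ge0. Qed.

Lemma gnorm_coef f S : normc (f S) * t ^+ #|S| <= gnorm t f.
Proof.
rewrite /gnorm (bigD1 S) //= lerDl sumr_ge0 // => T _.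
exact: gnorm_term_ge0.
Qed.

Lemma gnorm0 : gnorm t 0 = 0.
Proof. by apply: big1 => S _; rewrite ffunE normc0 mul0r. Qed.

Lemma gnorm1 : gnorm t 1 = 1.
Proof.
rewrite /gnorm (bigD1 set0) //= gcoef1 eqxx normc1 cards0 mul1r.
rewrite big1 ?addr0 // => S /negPf S0.
by rewrite gcoef1 S0 normc0 mul0r.
Qed.

Lemma gnormN f : gnorm t (- f) = gnorm t f.
Proof. by apply: eq_bigr => S _; rewrite gcoefN normcN. Qed.

Lemma gnormD f g : gnorm t (f + g) <= gnorm t f + gnorm t g.
Proof.
rewrite -big_split /=; apply: ler_sum => S _.
rewrite gcoefD -mulrDl ler_wpM2r ?le_normcD //.
by rewrite exprn_ge0 // ltW.
Qed.

Lemma gnorm_sum (I : Type) (r : seq I) (P : pred I) (F : I -> Lam) :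
  gnorm t (\sum_(i <- r | P i) F i) <= \sum_(i <- r | P i) gnorm t (F i).
Proof.
elim/big_rec2: _ => [|i x y _ yx]; first by rewrite gnorm0.
by rewrite (le_trans (gnormD _ _)) // lerD2l.
Qed.

(** The weight [t ^+ #|S|] is multiplicative on products of disjoint monomials,
    and the other products of monomials vanish. *)
Lemma gnormM f g : gnorm t (f * g) <= gnorm t f * gnorm t g.
Proof.
rewrite {2}/gnorm mulr_suml.
under [leRHS]eq_bigr do rewrite mulr_sumr.
apply: (@le_trans _ _ (\sum_(S : {set 'I_q}) \sum_(T : {set 'I_q} | T \subset S)
   (normc (f T) * t ^+ #|T|) * (normc (g (S :\: T)) * t ^+ #|S :\: T|))).
  apply: ler_sum => S _; rewrite gcoefM.
  apply: le_trans (ler_wpM2r _ (normc_sum _ _ _)) _.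
    by rewrite exprn_ge0 // ltW.
  rewrite mulr_suml; apply: ler_sum => T TS.
  rewrite !normcM normc_sign mul1r mulrACA -exprD.
  by rewrite cardsD (setIidPr TS) subnKC ?subset_leq_card.
rewrite (exchange_big_dep xpredT) //=; apply: ler_sum => T _.
rewrite (reindex_onto (fun U => U :|: T) (fun S => S :\: T)) /=; last first.
  move=> S TS; apply/setP => i; rewrite !inE.
  by have := subsetP TS i; case: (i \in T) => //= [->|_]; rewrite ?orbF.
rewrite big_mkcond /=; apply: ler_sum => U _.
case: ifP => [/andP[_ /eqP ->] //|_].
by rewrite mulr_ge0 ?gnorm_term_ge0.
Qed.

Lemma gnormX f k : gnorm t (f ^+ k) <= gnorm t f ^+ k.
Proof.
elim: k => [|k IH]; first by rewrite gnorm1.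
by rewrite !exprS (le_trans (gnormM _ _)) // ler_wpM2l // gnorm_ge0.
Qed.

Lemma gnorm_prod (I : Type) (r : seq I) (F : I -> Lam) :
  gnorm t (\prod_(i <- r) F i) <= \prod_(i <- r) gnorm t (F i).
Proof.
elim/big_rec2: _ => [|i x y _ yx]; first by rewrite gnorm1.
by rewrite (le_trans (gnormM _ _)) // ler_wpM2l ?gnorm_ge0.
Qed.

(** Expanding both products, the left side is a signed sum of products of the
    [F i], and the right side is the sum of the corresponding products of
    norms. *)
Lemma gnorm_prod1B (I : Type) (r : seq I) (F : I -> Lam) :
  gnorm t (\prod_(i <- r) (1 - F i) - 1) <=
    \prod_(i <- r) (1 + gnorm t (F i)) - 1.
Proof.
elim/big_rec2: _ => [|i x y _ yx]; first by rewrite !subrr gnorm0.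
have -> : (1 - F i) * y - 1 = (1 - F i) * (y - 1) - F i.
  by rewrite mulrBr mulr1 -[RHS]addrA opprB addrAC subrr add0r.
have -> : (1 + gnorm t (F i)) * x - 1 =
          (1 + gnorm t (F i)) * (x - 1) + gnorm t (F i).
  by rewrite mulrBr mulr1 -[RHS]addrA opprD addrNK.
rewrite (le_trans (gnormD _ _)) // gnormN lerD2r.
rewrite (le_trans (gnormM _ _)) // ler_pM ?gnorm_ge0 //.
by rewrite (le_trans (gnormD _ _)) // gnormN gnorm1.
Qed.

End FixedWeight.

Local Open Scope classical_set_scope.

(** For [t <= 1] the norm is at most [|body w| + t * C], where [C] is the sum
    of the absolute values of the coefficients. *)
Lemma gnorm_near_lt1 w : normc (body w) < 1 ->
  \forall t \near 0^'+, gnorm t w < 1.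
Proof.
move=> w1; pose C := \sum_(S : {set 'I_q}) normc (w S).
have C_ge0 : 0 <= C by apply: sumr_ge0 => S _; apply: normc_ge0.
near=> t.
have t_gt0 : 0 < t by [].
have t_le1 : t <= 1 by near: t; apply: nbhs_right_le.
have tC : t < (1 - normc (body w)) / (1 + C).
  by near: t; apply: nbhs_right_lt; rewrite divr_gt0 ?subr_gt0 // ltr_pwDl.
apply: (@le_lt_trans _ _ (normc (body w) + t * C)).
  rewrite /gnorm (bigD1 set0) //= cards0 mulr1 lerD2l.
  rewrite mulr_sumr [leRHS](bigD1 set0) //=; apply: ler_wpDl.
    by rewrite mulr_ge0 ?normc_ge0 // ltW.
  apply: ler_sum => S S0; rewrite mulrC ler_wpM2r ?normc_ge0 //.
  have : (0 < #|S|)%N by rewrite card_gt0.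
  by case: #|S| => // k _; rewrite exprS ger_pMr // exprn_ile1 // ltW.
rewrite -ltrBrDl (le_lt_trans _ (_ : t * (1 + C) < _)) //.
  by rewrite ler_wpM2l ?lerDr // ltW.
by rewrite -ltr_pdivlMr // ltr_pwDl.
Unshelve. all: by end_near. Qed.

Lemma exists_weight (I : finType) (w : I -> Lam) :
  (forall i, normc (body (w i)) < 1) ->
  exists2 t, 0 < t & forall i, gnorm t (w i) < 1.
Proof.
move=> w1.
have t1 : \forall t \near 0^'+, forall i, gnorm t (w i) < 1.
  by apply: filter_forall => i; apply: gnorm_near_lt1.
near (0 : R)^'+ => t; exists t => //.
by near: t.
Unshelve. all: by end_near. Qed.

End WeightedNorm.

(** * Unconditional sums *)

#[local] Existing Instance totally_filter.

Section FiniteSums.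
Local Open Scope classical_set_scope.
Local Open Scope fset_scope.
Local Open Scope ring_scope.
Variable I : choiceType.
Implicit Types A B : {fset I}.

Lemma fsum_diff (V : zmodType) (F : I -> V) A B : A `<=` B ->
  \sum_(i <- B) F i - \sum_(i <- A) F i = \sum_(i <- B `\` A) F i.
Proof.
move=> AB; rewrite (big_fsetID _ (mem A) B) /=.
have -> : [fset x in B | x \in A] = A.
  apply/fsetP => i; rewrite !inE andbC; have := fsubsetP AB i.
  by case: (i \in A) => //= ->.
rewrite addrAC subrr add0r; apply: eq_fbigl => i.
by rewrite !inE andbC.
Qed.

Lemma ler_fsum (R : numDomainType) (F : I -> R) A B :
  (forall i, 0 <= F i) -> A `<=` B ->
  \sum_(i <- A) F i <= \sum_(i <- B) F i.
Proof. by move=> F0 AB; rewrite -subr_ge0 fsum_diff // sumr_ge0. Qed.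

Lemma totally_cauchy_cvg (R : realType) (u : {fset I} -> R) :
  (forall e, 0 < e -> exists A, forall B, A `<=` B -> `|u B - u A| < e) ->
  exists a, forall e, 0 < e ->
    exists A, forall B, A `<=` B -> `|u B - a| < e.
Proof.
move=> uC.
have uc : cvg (u @ totally).
  apply: cauchy_cvg; apply/cauchyP => e e0; have [A uA] := uC _ e0.
  exists (u A), A => //= B /uA; by rewrite distrC.
exists (lim (u @ totally)) => e e0.
have [A _ uA] := (cvgrPdist_lt _ _).1 uc _ e0.
by exists A => B /uA; rewrite distrC.
Qed.

End FiniteSums.

Section GrassmannSums.
Local Open Scope classical_set_scope.
Local Open Scope fset_scope.
Local Open Scope ring_scope.
Variables (R : realType) (q : nat).
Local Notation Lam := (grassmann R[i] q).
Implicit Types (S : {set 'I_q}) (l c : Lam) (t e : R).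

Lemma normc_leD (x y : R) : normc (x +i* y) <= `|x| + `|y|.
Proof.
rewrite /= -[leRHS]ger0_norm ?addr_ge0 // -(sqrtr_sqr (_ + _)) ler_wsqrtr //.
rewrite sqrrD !real_normK ?num_real // -addrA lerD2l.
by rewrite lerDr mulrn_wge0 // mulr_ge0.
Qed.

Section Family.
Variable I : choiceType.
Implicit Types (A B : {fset I}) (f g : I -> Lam).

Lemma cvg_coefP f (a : R[i]) S : gpartial_sums f S --> (a : R[i]^o) <->
  forall e, 0 < e -> exists A, forall B, A `<=` B ->
    normc ((\sum_(i <- B) f i) S - a) < e.
Proof.
have psE B : partial_sum (fun i => f i S : R[i]^o) B = (\sum_(i <- B) f i) S.
  by rewrite gcoef_sum big_seq_fsetE.
split=> [/cvgrPdist_lt fa e e0|fa].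
  have /fa [A _ fA] : 0 < e%:C :> R[i] by rewrite ltcR.
  by exists A => B /fA /=; rewrite psE distrC ltcR.
apply/cvgrPdist_lt => /= e; rewrite ltcE /= => /andP[/eqP e0 /fa[A fA]].
exists A => //= B /fA; rewrite psE distrC [e]complexE e0 mulr0 addr0.
by rewrite -ltcR.
Qed.

Section Weight.
Variables (t : R) (t_gt0 : 0 < t).

(** All weights define the same topology, that of coefficientwise convergence,
    because there are finitely many coefficients. *)
Lemma ghas_sumP f l : ghas_sum f l <->
  forall e, 0 < e -> exists A, forall B, A `<=` B ->
    gnorm t (\sum_(i <- B) f i - l) < e.
Proof.
split=> [fl e e0|fl S]; last first.
  apply/cvg_coefP => e e0; have tS : 0 < t ^+ #|S| by rewrite exprn_gt0.
  have [A fA] := fl _ (mulr_gt0 e0 tS); exists A => B /fA.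
  rewrite -[X in _ -> is_true X](ltr_pM2r tS) -gcoefN -gcoefD.
  by apply: le_lt_trans; exact: gnorm_coef.
pose n := #|{: {set 'I_q}}|.
(* n.+1, so that the n errors add up to strictly less than e *)
have e'0 S : 0 < e / n.+1%:R / t ^+ #|S| by rewrite !divr_gt0 // exprn_gt0.
have fl' S : totally (fun B : {fset I} =>
    normc ((\sum_(i <- B) f i) S - l S) < e / n.+1%:R / t ^+ #|S|).
  have /cvg_coefP/(_ _ (e'0 S))[A fA] := fl S.
  by exists A.
have [A _ fA] := filter_forall totally_filter fl'.
exists A => B /fA /= fB.
apply: (@le_lt_trans _ _ (\sum_(S : {set 'I_q}) e / n.+1%:R)).
  apply: ler_sum => S _; rewrite gcoefD gcoefN.
  by rewrite -ler_pdivlMr ?exprn_gt0 // ltW.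
rewrite sumr_const -/n -[ltLHS]mulr_natr -mulrA gtr_pMr // mulrC.
by rewrite ltr_pdivrMr // mul1r ltr_nat.
Qed.

Definition abs_summable f M := forall B, \sum_(i <- B) gnorm t (f i) <= M.

Lemma abs_summable_cofinal f M :
  (forall A, exists2 B, A `<=` B & \sum_(i <- B) gnorm t (f i) <= M) ->
  abs_summable f M.
Proof.
move=> fM A; have [B AB] := fM A; apply: le_trans.
by apply: ler_fsum => // i; apply: gnorm_ge0.
Qed.

(** [A] is chosen so that its sum of norms is within [e] of the supremum, which
    leaves less than [e] for all the other indices. *)
Lemma abs_summable_cauchy f M : abs_summable f M ->
  forall e, 0 < e -> exists A, forall B, A `<=` B ->
    gnorm t (\sum_(i <- B) f i - \sum_(i <- A) f i) < e.
Proof.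
move=> fM e e0; pose E := range (fun B => \sum_(i <- B) gnorm t (f i)).
have supE : has_sup E.
  split; first by exists (\sum_(i <- fset0) gnorm t (f i)), fset0.
  by exists M => _ [B _ <-].
have [_ [A _ <-] supA] := sup_adherent e0 supE.
exists A => B AB; rewrite fsum_diff // (le_lt_trans (gnorm_sum _ _ _ _)) //.
rewrite -fsum_diff // ltrBlDr addrC -ltrBlDr (le_lt_trans _ supA) // lerB //.
by apply: ub_le_sup => //; [case: supE|exists B].
Qed.

(** The partial sums of each coefficient are Cauchy; their real and imaginary
    parts converge by completeness of the reals. *)
Lemma abs_summable_gsummable f M : abs_summable f M -> gsummable f.
Proof.
move=> /abs_summable_cauchy fC S; apply/cvg_ex.
have tS : 0 < t ^+ #|S| by rewrite exprn_gt0.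
have {}fC e : 0 < e -> exists A, forall B, A `<=` B ->
    normc ((\sum_(i <- B) f i) S - (\sum_(i <- A) f i) S) < e.
  move=> e0; have [A fA] := fC _ (mulr_gt0 e0 tS); exists A => B /fA.
  rewrite -[X in _ -> is_true X](ltr_pM2r tS) -gcoefN -gcoefD.
  by apply: le_lt_trans; exact: gnorm_coef.
have leRe (c : R[i]) : `|complex.Re c| <= normc c.
  by rewrite -lecR; apply: normc_ge_Re.
have leIm (c : R[i]) : `|complex.Im c| <= normc c.
  by case: c => a b; rewrite /= -sqrtr_sqr ler_wsqrtr // lerDr sqr_ge0.
have [|a fa] :=
    @totally_cauchy_cvg I R (fun B => complex.Re ((\sum_(i <- B) f i) S)).
  move=> e /fC[A fA]; exists A => B /fA; apply: le_lt_trans.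
  by rewrite -raddfB; apply: leRe.
have [|b fb] :=
    @totally_cauchy_cvg I R (fun B => complex.Im ((\sum_(i <- B) f i) S)).
  move=> e /fC[A fA]; exists A => B /fA; apply: le_lt_trans.
  by rewrite -raddfB; apply: leIm.
exists (a +i* b : R[i]^o); apply/cvg_coefP => e e0.
have e20 : 0 < e / 2 by rewrite divr_gt0.
have [[A fA] [B fB]] := (fa _ e20, fb _ e20).
exists (A `|` B) => C; rewrite fsubUset => /andP[/fA aC /fB bC].
rewrite (splitr e); apply: le_lt_trans (ltrD aC bC).
by case: (_ S) => x y /=; apply: normc_leD.
Qed.

(** For an absolutely summable family the sum may be computed along any cofinal
    family of finite sets of indices. *)
Lemma ghas_sum_cofinal f M l : abs_summable f M ->
  (forall A e, 0 < e ->
     exists2 B, A `<=` B & gnorm t (\sum_(i <- B) f i - l) < e) ->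
  ghas_sum f l.
Proof.
move=> /abs_summable_cauchy fC fl; apply/ghas_sumP => e e0.
have e20 : 0 < e / 2 / 2 by rewrite !divr_gt0.
have [A fA] := fC _ e20; have [B AB fB] := fl A _ e20.
exists A => C AC; rewrite -(subrKA (\sum_(i <- A) f i)).
rewrite (le_lt_trans (gnormD _ _ _)) // (splitr e); apply: ltrD.
  by rewrite (lt_trans (fA _ AC)) // gtr_pMr ?divr_gt0 // invf_lt1 ?ltr1n.
rewrite -(subrKA (\sum_(i <- B) f i)) (le_lt_trans (gnormD _ _ _)) //.
rewrite (splitr (e / 2)) ltrD // -opprB gnormN; exact: fA.
Qed.

End Weight.

Lemma eq_ghas_sum f g l : f =1 g -> ghas_sum f l -> ghas_sum g l.
Proof. by move=> /funext ->. Qed.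

Lemma ghas_sum_gsum f l : ghas_sum f l -> gsum f = l.
Proof.
by move=> fl; apply/ffunP => S; rewrite ffunE; apply: cvg_lim (fl S).
Qed.

Lemma gsummable_gsum f : gsummable f -> ghas_sum f (gsum f).
Proof. by move=> fs S; rewrite ffunE; apply: fs. Qed.

Lemma ghas_sum_gsummable f l : ghas_sum f l -> gsummable f.
Proof. by move=> fl S; apply/cvg_ex; exists (l S); apply: fl. Qed.

Lemma ghas_sumZ c f l : ghas_sum f l -> ghas_sum (fun i => c * f i) (c * l).
Proof.
move=> /(ghas_sumP ltr01) fl; apply/(ghas_sumP ltr01) => e e0.
have c0 : 0 < gnorm 1 c + 1 by rewrite ltr_wpDl ?gnorm_ge0.
have [A fA] := fl _ (divr_gt0 e0 c0); exists A => B /fA fB.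
rewrite -mulr_sumr -mulrBr (le_lt_trans (gnormM _ _ _)) //.
apply: (@le_lt_trans _ _
    ((gnorm 1 c + 1) * gnorm 1 (\sum_(i <- B) f i - l))).
  by rewrite ler_wpM2r ?gnorm_ge0 ?lerDl.
by rewrite mulrC -ltr_pdivlMr.
Qed.

End Family.

Section Fibres.
Variables (I J : choiceType) (d : I -> J) (f : I -> Lam).
Local Notation fibre j := {i : I | d i == j}.

Lemma abs_summable_fibre t M j :
  abs_summable t f M -> abs_summable t (fun b : fibre j => f (val b)) M.
Proof.
move=> fM B; apply: le_trans (fM [fset val b | b in B]).
by rewrite big_imfset //= => b c _ _ /val_inj.
Qed.

(** Given a large finite set [B] of values of [d], each fibre over [B] is
    replaced by a finite part [D j] whose sum is close to [g j] and which
    contains the part of [A] in this fibre.  The union of the [D j] then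
    contains [A], so its sum is close to [l]. *)
Lemma ghas_sum_fibres l (g : J -> Lam) : ghas_sum f l ->
  (forall j, ghas_sum (fun b : fibre j => f (val b)) (g j)) -> ghas_sum g l.
Proof.
move=> /(ghas_sumP ltr01) fl fg; apply/(ghas_sumP ltr01) => e e0.
have e20 : 0 < e / 2 by rewrite divr_gt0.
have [A fA] := fl _ e20; exists [fset d i | i in A] => B AB.
pose n := size B; pose e' := e / 2 / n.+1%:R.
have e'0 : 0 < e' by rewrite divr_gt0.
have /choice[D DP] j : exists D : {fset I},
    [/\ forall i, i \in D -> d i = j, forall i, i \in A -> d i = j -> i \in D
      & gnorm 1 (\sum_(i <- D) f i - g j) < e'].
  have [C fC] := (ghas_sumP ltr01 _ _).1 (fg j) _ e'0.
  pose C' : {fset fibre j} := C `|` [fset b in pmap insub A].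
  exists [fset val b | b in C']; split.
  - by move=> i /imfsetP[b _ ->]; apply/eqP/(valP b).
  - move=> i iA /eqP dij; apply/imfsetP; exists (Sub i dij) => //.
    by rewrite !inE mem_pmap_sub /= iA orbT.
  - rewrite big_imfset /=; last by move=> b c _ _ /val_inj.
    by apply: fC; apply: fsubsetUl.
pose C := \bigcup_(j <- B) D j.
have AC : A `<=` C.
  apply/fsubsetP => i iA; apply/bigfcupP; exists (d i).
    by rewrite andbT; apply: (fsubsetP AB); apply/imfsetP; exists i.
  by have [_ + _] := DP (d i); apply.
have sumC : \sum_(i <- C) f i = \sum_(j <- B) \sum_(i <- D j) f i.
  transitivity (\sum_(i <- C) \sum_(j <- B | d i == j) f i).
    rewrite big_seq [RHS]big_seq; apply: eq_bigr => i /bigfcupP[j].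
    rewrite andbT => jB iD; have [/(_ _ iD) dij _ _] := DP j.
    rewrite big_mkcond (bigD1_seq j) ?fset_uniq //= dij eqxx big1 ?addr0 //.
    by move=> k /negPf; rewrite eq_sym => ->.
  rewrite (exchange_big_dep xpredT) //= big_seq [RHS]big_seq.
  apply: eq_bigr => j jB; rewrite big_fset_condE; apply: eq_fbigl => i.
  have [Dd _ _] := DP j; rewrite !inE /=; apply/andP/idP => [[]|iD].
    move=> /bigfcupP[k]; rewrite andbT => kB iDk /eqP <-.
    by have [/(_ _ iDk) -> _ _] := DP k.
  split; last by apply/eqP/Dd.
  by apply/bigfcupP; exists j; rewrite ?jB.
rewrite -(subrKA (\sum_(i <- C) f i)) (le_lt_trans (gnormD _ _ _)) //.
rewrite [ltRHS]splitr ltrD ?fA // sumC -sumrB.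
rewrite (le_lt_trans (gnorm_sum _ _ _ _)) //.
apply: (@le_lt_trans _ _ (\sum_(j <- B) e')).
  apply: ler_sum => j _; rewrite -opprB gnormN.
  by have [_ _ /ltW] := DP j.
rewrite big_const_seq count_predT iter_addr_0 -/n /e'.
rewrite -[ltLHS]mulr_natr -mulrA gtr_pMr // mulrC.
by rewrite ltr_pdivrMr // mul1r ltr_nat.
Qed.

End Fibres.
End GrassmannSums.

(** * Products of geometric series *)

Section Boxes.
Local Open Scope fset_scope.
Local Open Scope ring_scope.
Variables n m : nat.
Local Notation Mon := (monomial n m).
Implicit Types b : Mon.

Definition box_emb L (p : {ffun 'I_n -> bool} * {ffun 'I_m -> 'I_L}) : Mon :=
  (p.1, [ffun mu => p.2 mu : nat]).

Lemma box_emb_inj L : injective (@box_emb L).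
Proof.
move=> [k l] [k' l'] [-> /ffunP ll']; congr (_, _); apply/ffunP => mu.
by apply: val_inj; have := ll' mu; rewrite !ffunE.
Qed.

Definition box L : {fset Mon} :=
  [fset box_emb p | p in {: {ffun 'I_n -> bool} * {ffun 'I_m -> 'I_L}}].

Lemma mem_box L b : (forall mu, b.2 mu < L)%N -> b \in box L.
Proof.
case: b => k l /= lL; apply/imfsetP.
exists (k, [ffun mu => Ordinal (lL mu)]) => //.
by congr (_, _); apply/ffunP => mu; rewrite !ffunE.
Qed.

Lemma box_exhaust (A : {fset Mon}) :
  exists L0, forall L, (L0 <= L)%N -> A `<=` box L.
Proof.
exists (\max_(b <- A) \max_mu b.2 mu).+1 => L AL; apply/fsubsetP => b bA.
apply: mem_box => mu; apply: leq_ltn_trans AL.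
apply: leq_trans (leq_bigmax_seq _ bA isT).
exact: (leq_bigmax (F := fun mu => b.2 mu)).
Qed.

Definition monom_eval (S : comNzRingType)
    (X : 'I_n -> S) (W : 'I_m -> S) b : S :=
  (\prod_a X a ^+ b.1 a) * \prod_mu W mu ^+ b.2 mu.

Lemma box_sum (S : comNzRingType) (X : 'I_n -> S) (W : 'I_m -> S) L :
  \sum_(b <- box L) monom_eval X W b =
    (\prod_a (1 + X a)) * \prod_mu \sum_(l < L) W mu ^+ l.
Proof.
rewrite big_imfset /=; last by move=> p p' _ _ /box_emb_inj.
transitivity (\sum_(k : {ffun 'I_n -> bool}) \sum_(l : {ffun 'I_m -> 'I_L})
   (\prod_a X a ^+ k a) * \prod_mu W mu ^+ l mu).
  rewrite pair_big /= big_enum /=; apply: eq_bigr => p _; congr (_ * _).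
  by apply: eq_bigr => mu _; rewrite ffunE.
rewrite -big_distrlr /= bigA_distr_bigA; congr (_ * _).
rewrite -(bigA_distr_bigA (fun a (k : bool) => X a ^+ k)).
by apply: eq_bigr => a _; rewrite big_bool /= expr1 expr0 addrC.
Qed.

End Boxes.

Section Geometric.
Local Open Scope classical_set_scope.
Local Open Scope ring_scope.
Variables (R : realType) (q n m : nat).
Local Notation Lam := (grassmann R[i] q).
Local Notation C := (centre Lam).
Variables (t : R) (t_gt0 : 0 < t).

Lemma prod_1Dexpr_cvg (r : 'I_m -> R) : (forall mu, 0 <= r mu < 1) ->
  (fun L => \prod_mu (1 + r mu ^+ L)) @ \oo --> (1 : R).
Proof.
move=> r1; have p1 : \prod_(mu < m) 1 = 1 :> R by rewrite big1.
rewrite -[X in _ --> X]p1.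
apply: (cvg_big (@mul_continuous R)) => mu _.
rewrite -[X in _ --> X]addr0; apply: cvgD; first exact: cvg_cst.
by apply: cvg_expr; have /andP[r0 r1'] := r1 mu; rewrite ger0_norm.
Qed.

Variables (X : 'I_n -> C) (W : 'I_m -> C).
Hypothesis W_lt1 : forall mu, gnorm t (val (W mu)) < 1.

Let f (b : monomial n m) : Lam := val (monom_eval X W b).

Lemma unit_1B (w : C) : gnorm t (val w) < 1 -> 1 - w \is a GRing.unit.
Proof.
move=> w1; rewrite -val_unit; apply: gunit_body; rewrite unitfE.
rewrite rmorphB rmorph1 bodyD bodyN body1 subr_eq0.
apply/eqP => w0; have := le_lt_trans (gnorm_coef t_gt0 (val w) set0) w1.
by rewrite -[_ set0]/(body _) -w0 normc1 cards0 mulr1 ltxx.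
Qed.

Lemma geometric_abs_summable : exists M, abs_summable t f M.
Proof.
pose gX a := gnorm t (val (X a)); pose gW mu := gnorm t (val (W mu)).
exists ((\prod_a (1 + gX a)) * \prod_mu (1 - gW mu)^-1).
apply: (abs_summable_cofinal t_gt0) => A; have [L AL] := box_exhaust A.
exists (box n m L); first exact: AL.
apply: (@le_trans _ _ (\sum_(b <- box n m L) monom_eval gX gW b)).
  apply: ler_sum => b _; rewrite /f /monom_eval rmorphM !rmorph_prod.
  rewrite (le_trans (gnormM _ _ _)) // ler_pM ?gnorm_ge0 //;
    rewrite (le_trans (gnorm_prod _ _ _)) //; apply: ler_prod => i _;
    by rewrite gnorm_ge0 // rmorphXn gnormX.
rewrite box_sum ler_wpM2l //.
  by apply: prodr_ge0 => a _; rewrite addr_ge0 ?gnorm_ge0.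
apply: ler_prod => mu _; rewrite sumr_ge0 => [|l _]; last first.
  by rewrite exprn_ge0 ?gnorm_ge0.
have gW1 : 0 < 1 - gW mu by rewrite subr_gt0 W_lt1.
rewrite -[leRHS]mul1r ler_pdivlMr // mulrC -opprB mulNr -subrX1 opprB.
by rewrite gerBl exprn_ge0 // gnorm_ge0.
Qed.

(** The sum over the box of size [L] differs from the expected value by the
    factor [\prod_mu (1 - W mu ^+ L)], which tends to 1. *)
Lemma geometric_ghas_sum :
  ghas_sum f (val ((\prod_a (1 + X a)) * \prod_mu (1 - W mu)^-1)).
Proof.
have [M fM] := geometric_abs_summable; apply: (ghas_sum_cofinal t_gt0 fM).
move=> A e e0; set P := _ * _.
have boxE L : \sum_(b <- box n m L) f b =
    val P * \prod_mu (1 - val (W mu) ^+ L).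
  rewrite -rmorph_sum box_sum /P.
  have -> : \prod_mu (1 - val (W mu) ^+ L) = val (\prod_mu (1 - W mu ^+ L)).
    rewrite rmorph_prod; apply: eq_bigr => mu _.
    by rewrite rmorphB rmorph1 rmorphXn.
  rewrite -rmorphM -mulrA -big_split /=; congr (_ * cval _).
  apply: eq_bigr => mu _; apply: (mulrI (unit_1B (W_lt1 mu))).
  by rewrite mulVKr ?unit_1B // -opprB mulNr -subrX1 opprB.
pose r mu := gnorm t (val (W mu)).
have r1 mu : 0 <= r mu < 1 by rewrite gnorm_ge0 // W_lt1.
have P0 : 0 < gnorm t (val P) + 1 by rewrite ltr_wpDl ?gnorm_ge0.
have [L1 AL] := box_exhaust A.
have /cvgrPdist_lt/(_ _ (divr_gt0 e0 P0)) [L2 _ L2P] := prod_1Dexpr_cvg r1.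
pose L := maxn L1 L2; exists (box n m L); first by rewrite AL ?leq_maxl.
rewrite boxE -{2}[val P]mulr1 -mulrBr.
have := L2P L (leq_maxr _ _); rewrite /= distrC ltr_pdivlMr // mulrC => le.
apply: le_lt_trans le; rewrite (le_trans (gnormM _ _ _)) //.
apply: ler_pM; rewrite ?gnorm_ge0 ?lerDl //.
apply: le_trans (ler_norm _); apply: le_trans (gnorm_prod1B _ _ _) _ => //.
rewrite lerB // ler_prod // => mu _; rewrite addr_ge0 ?gnorm_ge0 //= lerD2l.
exact: gnormX.
Qed.

End Geometric.

(** * Signed eigenvalues as terms of geometric series *)

Definition meigenvalue (K : unitRingType) n m s (x : 'I_n -> K) (y : 'I_m -> K)
    (b : monomial n m) : K :=
  (\prod_(a < n) x a ^+ b.1 a)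
  * (\prod_(mu < m | (mu < m - s)%N) y mu ^+ b.2 mu)
  * (\prod_(mu < m | (m - s <= mu)%N) y mu ^- (b.2 mu).+1).

Section Monomials.
Variables (K : comUnitRingType) (n m s : nat).
Variables (z : K) (x : 'I_n -> K) (y : 'I_m -> K).
Hypothesis z_unit : z \is a GRing.unit.
Hypothesis y_unit : forall mu : 'I_m, (m - s <= mu)%N -> y mu \is a GRing.unit.
Implicit Types b : monomial n m.

(** The ratio of the geometric series that expands [(1 + z * y mu)^-1], in
    powers of [z * y mu] below the annulus and of its inverse above it. *)
Definition ratio (mu : 'I_m) : K :=
  if (mu < m - s)%N then - (z * y mu) else - (z * y mu)^-1.

Definition prefactor : K := \prod_(mu < m | (m - s <= mu)%N) (z * y mu)^-1.

Lemma card_delta : (s <= m)%N -> (\sum_(mu < m | (m - s <= mu)%N) 1 = s)%N.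
Proof.
move=> s_le_m; have : (\sum_(mu < m) 1 = m)%N by rewrite sum1_card card_ord.
rewrite (bigID (fun mu : 'I_m => (mu < m - s)%N)) /=.
under [X in (_ + X)%N = _ -> _]eq_bigl do rewrite -leqNgt.
rewrite -(big_ord_widen m (fun=> 1%N)) ?leq_subr // sum1_card card_ord => sum_m.
by apply/eqP; rewrite -(eqn_add2l (m - s)) sum_m subnK.
Qed.

Lemma prod_delta (c : K) : (s <= m)%N ->
  \prod_(mu < m | (m - s <= mu)%N) c = c ^+ s.
Proof. by move=> s_le_m; rewrite -[in RHS]card_delta // -prodrXr. Qed.

Lemma monomial_term (s_le_m : (s <= m)%N) b :
  z ^ mdegree s b * (-1) ^ mdegree s b
    * ((-1) ^+ mparity s b * meigenvalue s x y b)
  = prefactor * monom_eval (fun a => z * x a) ratio b.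
Proof.
(* Both the power of z and the sign of the degree are powers of u = - z. *)
pose u := - z; have u_unit : u \is a GRing.unit by rewrite unitrN.
have uV : u^-1 = - z^-1 by rewrite invrN.
rewrite (mulrC (z ^ _)) -expNrz -/u.
have -> : u ^ mdegree s b = (\prod_a u ^+ b.1 a)
    * (\prod_(mu < m | (mu < m - s)%N) u ^+ b.2 mu)
    * (\prod_(mu < m | (m - s <= mu)%N) u^-1 ^+ (b.2 mu).+1).
  rewrite /mdegree !exprzDr // -!exprz_inv -!exprnP.
  rewrite -!prodrXr -mulrA -prod_delta // -big_split /=.
  by congr (_ * _); apply: eq_bigr => mu _; rewrite exprS.
have -> : (-1) ^+ mparity s b = (\prod_a (-1) ^+ b.1 a)
    * \prod_(mu < m | (m - s <= mu)%N) (-1) :> K.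
  by rewrite /mparity signr_odd exprD prod_delta // -prodrXr.
rewrite /meigenvalue /monom_eval /prefactor.
rewrite [X in _ = _ * (_ * X)](bigID (fun mu : 'I_m => (mu < m - s)%N)) /=.
under [X in _ = _ * (_ * (_ * X))]eq_bigl do rewrite -leqNgt.
have regroup ku lu hu k1 h1 kx ly hy :
    ku * lu * hu * (k1 * h1 * (kx * ly * hy)) =
    (ku * k1 * kx) * ((lu * ly) * (hu * h1 * hy)) :> K by ring.
rewrite regroup {regroup}.
rewrite [RHS]mulrCA; congr (_ * _).
  rewrite -!big_split /=; apply: eq_bigr => a _.
  by rewrite -exprMn mulrN1 opprK exprMn.
rewrite [RHS]mulrCA; congr (_ * _).
  rewrite -big_split /=; apply: eq_bigr => mu lt; rewrite /ratio lt.
  by rewrite -exprMn mulNr.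
rewrite -!big_split /=; apply: eq_bigr => mu le; rewrite /ratio ltnNge le /=.
rewrite uV -exprVn invrM ?y_unit // -mulrN exprMn !exprS.
by set v := (- _) ^+ _; set w := _^-1 ^+ _; ring.
Qed.

(** Above the annulus, [w^-1 * (1 + w^-1)^-1 = (1 + w)^-1] for
    [w = z * y mu]. *)
Lemma prefactor_mul_geometric : (forall mu, 1 + z * y mu \is a GRing.unit) ->
  prefactor * ((\prod_a (1 + z * x a)) * \prod_mu (1 - ratio mu)^-1) =
  (\prod_a (1 + z * x a)) * (\prod_mu (1 + z * y mu))^-1.
Proof.
move=> zy1_unit; rewrite mulrCA; congr (_ * _).
rewrite -prodrV // /prefactor.
rewrite [X in _ * X = _](bigID (fun mu : 'I_m => (mu < m - s)%N)) /=.
rewrite [RHS](bigID (fun mu : 'I_m => (mu < m - s)%N)) /= mulrCA.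
under [X in _ * (_ * X) = _]eq_bigl do rewrite -leqNgt.
under [X in _ = _ * X]eq_bigl do rewrite -leqNgt.
congr (_ * _).
  by apply: eq_bigr => mu lt; rewrite /ratio lt opprK.
rewrite -big_split /=; apply: eq_bigr => mu le; rewrite /ratio ltnNge le /=.
have zy_unit : z * y mu \is a GRing.unit by rewrite unitrM z_unit y_unit.
rewrite opprK.
have -> : 1 + (z * y mu)^-1 = (z * y mu)^-1 * (1 + z * y mu).
  by rewrite mulrDr mulr1 mulVr // addrC.
by rewrite invrM ?unitrV // invrK mulrCA mulVr ?mulr1.
Qed.

(** The two identities are transported along a ring morphism, to be used for
    the inclusion of the centre into a noncommutative ring. *)
Variables (G : unitRingType) (v : {rmorphism K -> G}).

Lemma rmorph_monomial_term (s_le_m : (s <= m)%N) b :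
  v z ^ mdegree s b * (-1) ^ mdegree s b
    * ((-1) ^+ mparity s b * meigenvalue s (v \o x) (v \o y) b)
  = v prefactor * v (monom_eval (fun a => z * x a) ratio b).
Proof.
rewrite -rmorphM -monomial_term // !rmorphM !rmorphXz ?unitrN1 // rmorphN1.
rewrite rmorphXn rmorphN1 !rmorph_prod /meigenvalue.
congr (_ * _ * (_ * (_ * _ * _))).
- by apply: eq_bigr => a _; rewrite rmorphXn.
- by apply: eq_bigr => mu _; rewrite rmorphXn.
- by apply: eq_bigr => mu le; rewrite rmorphV ?rmorphXn // unitrX // y_unit.
Qed.

Lemma rmorph_prefactor_mul_geometric :
    (forall mu, 1 + z * y mu \is a GRing.unit) ->
  v prefactor *
    v ((\prod_a (1 + z * x a)) * \prod_mu (1 - ratio mu)^-1) =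
  (\prod_a (1 + v z * v (x a))) * (\prod_mu (1 + v z * v (y mu)))^-1.
Proof.
move=> zy1_unit; rewrite -rmorphM prefactor_mul_geometric // rmorphM.
rewrite rmorphV ?unitr_prod // !rmorph_prod; congr (_ * _^-1);
  by apply: eq_bigr => i _; rewrite rmorphD rmorph1 rmorphM.
Qed.

End Monomials.

(** * The Laurent expansion *)

Section Laurent.
Variables (R : realType) (q n m s : nat).
Local Notation Lam := (grassmann R[i] q).
Hypothesis s_le_m : (s <= m)%N.
Variables (x : 'I_n -> Lam) (y : 'I_m -> Lam).
Hypotheses (x_even : forall a, geven (x a)) (y_even : forall mu, geven (y mu)).

Definition signed_eigenvalue (b : monomial n m) : Lam :=
  (-1) ^+ mparity s b * meigenvalue s x y b.

Definition laurent_term (z : Lam) (b : monomial n m) : Lam :=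
  z ^ mdegree s b * (-1) ^ mdegree s b * signed_eigenvalue b.

Definition in_annulus (z : Lam) :=
  (forall mu : 'I_m, (mu < m - s)%N -> normc (body z * body (y mu)) < 1) /\
  (forall mu : 'I_m, (m - s <= mu)%N -> 1 < normc (body z * body (y mu))).

Lemma bodyV (f : Lam) : f \is a GRing.unit -> body f^-1 = (body f)^-1.
Proof.
move=> fU; have ffV : body f * body f^-1 = 1 by rewrite -bodyM divrr // body1.
have f0 : body f != 0.
  by apply: contra_eqN ffV => /eqP ->; rewrite mul0r eq_sym oner_eq0.
by apply: (mulfI f0); rewrite ffV divff.
Qed.

Section Annulus.
Variables (z : Lam) (z_even : geven z).
Hypothesis z_annulus : in_annulus z.
Hypothesis z_unit : z \is a GRing.unit.

Lemma zy_unit (mu : 'I_m) : (m - s <= mu)%N -> y mu \is a GRing.unit.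
Proof.
move=> le; apply: gunit_body; rewrite unitfE; apply/eqP => y0.
by have := z_annulus.2 mu le; rewrite y0 mulr0 normc0 ltr10.
Qed.

Let zC : centre Lam := Centre (geven_central z_even).
Let xC a : centre Lam := Centre (geven_central (x_even a)).
Let yC mu : centre Lam := Centre (geven_central (y_even mu)).
Let W := ratio s zC yC.
Let X a : centre Lam := zC * xC a.

(** The annulus is where all the geometric series involved converge. *)
Lemma ratio_body_lt1 mu : normc (body (val (W mu))) < 1.
Proof.
rewrite /W /ratio; case: ltnP => mus.
  rewrite rmorphN rmorphM bodyN normcN bodyM; exact: z_annulus.1.
have zyU : zC * yC mu \is a GRing.unit.
  by rewrite unitrM -!val_unit /= z_unit zy_unit.
rewrite rmorphN bodyN normcN rmorphV // bodyV ?val_unit // rmorphM bodyM.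
by rewrite normcV invf_lt1 ?(lt_trans ltr01) ?z_annulus.2.
Qed.

Lemma oneDzy_unit mu : 1 + zC * yC mu \is a GRing.unit.
Proof.
rewrite -val_unit; apply: gunit_body; rewrite unitfE.
rewrite rmorphD rmorph1 rmorphM bodyD bodyM body1 addrC addr_eq0 /=.
apply/eqP => zy; have := z_annulus.1 mu; have := z_annulus.2 mu.
rewrite zy normcN normc1 ltxx.
by case: ltnP => _ h1 h2; [have := h2 isT|have := h1 isT].
Qed.

Lemma laurent_termE b :
  laurent_term z b = val (prefactor s zC yC) * val (monom_eval X W b).
Proof.
have yC_unit (mu : 'I_m) : (m - s <= mu)%N -> yC mu \is a GRing.unit.
  exact: zy_unit.
exact: (@rmorph_monomial_term _ n m s zC xC yC z_unit yC_unit Lam val s_le_m).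
Qed.

Lemma laurent_ghas_sum : ghas_sum (laurent_term z)
  ((\prod_a (1 + z * x a)) * (\prod_mu (1 + z * y mu))^-1).
Proof.
have [t t0 W1] := exists_weight ratio_body_lt1.
have yC_unit (mu : 'I_m) : (m - s <= mu)%N -> yC mu \is a GRing.unit.
  exact: zy_unit.
have <- := @rmorph_prefactor_mul_geometric _ n m s zC xC yC z_unit yC_unit
  Lam val oneDzy_unit.
have -> : laurent_term z =
    fun b => val (prefactor s zC yC) * val (monom_eval X W b).
  by apply/funext => b; apply: laurent_termE.
have sumW := geometric_ghas_sum (X := X) t0 W1.
exact: (@ghas_sumZ _ _ _ (val (prefactor s zC yC)) _ _ sumW).
Qed.

(** For a fixed degree, [z] enters the terms only through a common unit factor,
    which is divided out of an absolutely summable family. *)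
Lemma laurent_gsummable N :
  gsummable (fun b : {b : monomial n m | mdegree s b == N} =>
    signed_eigenvalue (val b)).
Proof.
have [t t0 W1] := exists_weight ratio_body_lt1.
have [M fM] := geometric_abs_summable t0 X W1.
pose u := z ^ N * (-1) ^ N.
have u_unit : u \is a GRing.unit by rewrite unitrMr unitrXz // unitrN1.
have termE (b : {b : monomial n m | mdegree s b == N}) :
    signed_eigenvalue (val b) =
    u^-1 * val (prefactor s zC yC) * val (monom_eval X W (val b)).
  by rewrite -mulrA -laurent_termE /laurent_term (eqP (valP b)) mulKr.
have fN := abs_summable_gsummable t0
  (abs_summable_fibre (d := @mdegree n m s) (j := N) fM).
have sumN := @ghas_sumZ _ _ _ (u^-1 * val (prefactor s zC yC)) _ _
  (gsummable_gsum fN).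
by rewrite (funext termE); exact: ghas_sum_gsummable sumN.
Qed.

End Annulus.
End Laurent.

(** * Berezinian and supertraces of a diagonal operator *)

Section BerDiagonal.
Variables (K : comNzRingType) (q n m : nat).
Local Notation Lam := (grassmann K q).

Lemma det_diagonal (S : nzRingType) p (M : 'M[S]_p) :
  (forall i j, i != j -> M i j = 0) -> \det M = \prod_i M i i.
Proof.
move=> M0; rewrite /determinant (bigD1 (1%g : 'S_p)) //= odd_perm1 mul1r.
rewrite [X in _ + X]big1 ?addr0 => [|sg sg1].
  by apply: eq_bigr => i _; rewrite perm1.
have [i sgi] : exists i, i != sg i.
  apply/existsP; apply: contraNT sg1; rewrite negb_exists => /forallP sg_id.
  apply/eqP/permP => i; rewrite perm1; apply/esym/eqP.
  by have := sg_id i; rewrite negbK.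
have -> : \prod_i M i (sg i) = 0; last by rewrite mulr0.
elim: (index_enum _) (mem_index_enum i) => // j r IH.
rewrite inE big_cons => /predU1P[<-|/IH ->]; last by rewrite mulr0.
by rewrite M0 // mul0r.
Qed.

(** The off-diagonal blocks vanish, and the two determinants reduce to the
    products of diagonal entries, taken in increasing order since the
    coefficients need not commute. *)
Lemma Ber_diagonal
    (B : vec K q (std_superspace n m) -> vec K q (std_superspace n m))
    (a : 'I_n -> Lam) (d : 'I_m -> Lam) :
  (forall j, B (even_bvec K q m j) = (a j : Lam^c) *: even_bvec K q m j) ->
  (forall j, B (odd_bvec K q n j) = (d j : Lam^c) *: odd_bvec K q n j) ->
  Ber B = (\prod_j a j) * (\prod_j d j)^-1.
Proof.
move=> Ba Bd; rewrite /Ber.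
have -> : \matrix_(i < n, j < m) B (odd_bvec K q n j) (inl i) = 0.
  by apply/matrixP => i j; rewrite !mxE Bd /= mul0r.
rewrite !mul0mx subr0; congr (_ * _^-1).
  rewrite det_diagonal => [|i j ij].
    by apply: eq_bigr => j _; rewrite !mxE Ba /= eqxx mul1r.
  by rewrite mxE Ba /= (inj_eq inl_inj) (negPf ij) mul0r.
rewrite det_diagonal => [|i j ij].
  by apply: eq_bigr => j _; rewrite !mxE Bd /= eqxx mul1r.
by rewrite mxE Bd /= (inj_eq inr_inj) (negPf ij) mul0r.
Qed.

End BerDiagonal.

Lemma exprz_sign (G : unitRingType) (N : int) :
  (-1) ^ N = (-1) ^+ `|N|%N :> G.
Proof. by case: N => k //=; rewrite NegzE -exprnN -exprVn invrN1. Qed.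

Section DiagonalOperator.
Variables (R : realType) (q n m : nat).
Local Notation Lam := (grassmann R[i] q).
Local Notation V := (std_superspace n m).
Variables (A : vec R[i] q V -> vec R[i] q V).
Variables (x : 'I_n -> Lam) (y : 'I_m -> Lam).
Hypothesis A_x : forall a : 'I_n, A (even_bvec R[i] q m a)
       = (x a : Lam^c) *: even_bvec R[i] q m a.
Hypothesis A_y : forall mu : 'I_m, A (odd_bvec R[i] q n mu)
       = (y mu : Lam^c) *: odd_bvec R[i] q n mu.

Lemma diag_coef_even a : diag_coef (Pi_op A) (inl a) = x a.
Proof.
rewrite /diag_coef /=.
have -> : unPin_vec (bvec R[i] q (W := Pi V) (inl a)) = even_bvec R[i] q m a.
  exact/val_inj.
by rewrite A_x /= eqxx mul1r.
Qed.

Lemma diag_coef_odd mu : diag_coef (Pi_op A) (inr mu) = y mu.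
Proof.
rewrite /diag_coef /=.
have -> : unPin_vec (bvec R[i] q (W := Pi V) (inr mu)) = odd_bvec R[i] q n mu.
  exact/val_inj.
by rewrite A_y /= eqxx mul1r.
Qed.

Lemma str_term_S N s (b : hbasis (S_superspace n m N s)) :
  str_term (S_op N s (Pi_op A)) b = signed_eigenvalue s x y (val b).
Proof.
congr (_ * _).
transitivity (S_eigenvalue (Pi_op A) b * (b == b)%:R); first by [].
rewrite eqxx mulr1.
by rewrite -(funext diag_coef_even) -(funext diag_coef_odd).
Qed.

Lemma str_term_Pin N W (B : vec R[i] q W -> vec R[i] q W) b :
  str_term (Pin_op N B) b = (-1) ^ N * str_term B b.
Proof.
rewrite /str_term /= signr_addb signr_odd -mulrA.
have -> : unPin_vec (N := N) (W := W) (bvec R[i] q b) =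
    bvec R[i] q (W := W) b by exact/val_inj.
by rewrite !mulrA exprz_sign; congr (_ * _); exact/commr_sym/commr_sign.
Qed.

Lemma Ber_1DzA (z : Lam) : (forall a, GRing.comm z (x a)) ->
  (forall mu, GRing.comm z (y mu)) ->
  Ber (fun v => v + (z : Lam^c) *: A v) =
  (\prod_a (1 + z * x a)) * (\prod_mu (1 + z * y mu))^-1.
Proof.
move=> zx zy; apply: Ber_diagonal => j.
  by rewrite A_x scalerA zx -[X in X + _]scale1r -scalerDl.
by rewrite A_y scalerA zy -[X in X + _]scale1r -scalerDl.
Qed.

End DiagonalOperator.

Theorem theorem8p3 (R : realType) (q n m : nat)
    (A : {linear vec R[i] q (std_superspace n m) ->
                 vec R[i] q (std_superspace n m)})
    (A_even : even_operator A) (A_inv : bijective A)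
    (x : 'I_n -> grassmann R[i] q) (y : 'I_m -> grassmann R[i] q)
    (x_even : forall a, geven (x a)) (y_even : forall mu, geven (y mu))
    (A_x : forall a : 'I_n, A (even_bvec R[i] q m a)
       = (x a : (grassmann R[i] q)^c) *: even_bvec R[i] q m a)
    (A_y : forall mu : 'I_m, A (odd_bvec R[i] q n mu)
       = (y mu : (grassmann R[i] q)^c) *: odd_bvec R[i] q n mu)
    (y_lt : forall mu nu : 'I_m, (mu < nu)%N ->
       `|body (y mu)| < `|body (y nu)|)
    (s : nat) (s_gt0 : (0 < s)%N) (s_ltm : (s < m)%N)
    (* y lo and y hi are the eigenvalues y_{m-s} and y_{m-s+1}, counted from 1 *)
    (lo hi : 'I_m) (lo_def : lo.+1 = (m - s)%N) (hi_def : hi = (m - s)%N :> nat) :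
  (forall N : int,
     gsummable (str_term (S_op N s (Pi_op A))) /\
     gsummable (str_term (Pin_op N (S_op N s (Pi_op A))))) /\
  forall z : grassmann R[i] q, geven z ->
    `|body (y hi)|^-1 < `|body z| < `|body (y lo)|^-1 ->
    let EzA v := v + (z : (grassmann R[i] q)^c) *: A v in
    ghas_sum (fun N : int => z ^ N * (-1) ^ N * Str (S_op N s (Pi_op A)))
      (Ber EzA) /\
    ghas_sum (fun N : int => z ^ N * Str (Pin_op N (S_op N s (Pi_op A))))
      (Ber EzA).
Proof.
have s_le_m := ltnW s_ltm.
pose Y mu := normc (body (y mu)).
have Y_lt (mu nu : 'I_m) : (mu < nu)%N -> Y mu < Y nu.
  by move=> /y_lt; rewrite !norm_normc ltcR.
have Y_le (mu nu : 'I_m) : (mu <= nu)%N -> Y mu <= Y nu.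
  rewrite leq_eqVlt => /predU1P[/val_inj -> //|/Y_lt/ltW //].
have Y_lo_hi : Y lo < Y hi by apply: Y_lt; rewrite hi_def -lo_def.
have Y_lo_ge0 : 0 <= Y lo by apply: normc_ge0.
have annulus (z : grassmann R[i] q) :
    normc (body z) * Y lo < 1 -> 1 < normc (body z) * Y hi -> in_annulus s y z.
  move=> z_lo z_hi; split=> mu mus; rewrite normcM.
    apply: le_lt_trans z_lo; rewrite ler_wpM2l ?normc_ge0 //.
    by apply: Y_le; rewrite -ltnS lo_def.
  apply: lt_le_trans z_hi _; rewrite ler_wpM2l ?normc_ge0 //.
  by apply: Y_le; rewrite hi_def.
have z_unit (z : grassmann R[i] q) : 1 < normc (body z) * Y hi ->
    z \is a GRing.unit.
  move=> z_hi; apply: gunit_body; rewrite unitfE; apply: contraTN z_hi.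
  by move=> /eqP ->; rewrite normc0 mul0r -leNgt.
have summable_S N : gsummable (str_term (S_op N s (Pi_op A))).
  (* The reciprocal of the midpoint of |y_lo| and |y_hi| lies in the annulus. *)
  pose r := 2 / (Y lo + Y hi).
  have Y_gt0 : 0 < Y lo + Y hi by rewrite ltr_wpDl // (le_lt_trans _ Y_lo_hi).
  have body_r : normc (body (gscalar q r%:C)) = r.
    rewrite gscalar_body /= expr0n addr0 sqrtr_sqr ger0_norm //.
    by rewrite divr_ge0 // ltW.
  have r_lo : normc (body (gscalar q r%:C)) * Y lo < 1.
    by rewrite body_r mulrAC ltr_pdivrMr // mul1r mulr_natl mulr2n ltrD2l.
  have r_hi : 1 < normc (body (gscalar q r%:C)) * Y hi.
    by rewrite body_r mulrAC ltr_pdivlMr // mul1r mulr_natl mulr2n ltrD2r.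
  have := laurent_gsummable s_le_m x_even y_even (gscalar_even q r%:C)
    (annulus _ r_lo r_hi) (z_unit _ r_hi) (N := N).
  by congr gsummable; apply/funext => b; rewrite (str_term_S A_x A_y).
have Pin_sum N : ghas_sum (str_term (Pin_op N (S_op N s (Pi_op A))))
    ((-1) ^ N * Str (S_op N s (Pi_op A))).
  have := @ghas_sumZ _ _ _ ((-1) ^ N) _ _ (gsummable_gsum (summable_S N)).
  by congr ghas_sum; apply/funext => b; rewrite str_term_Pin.
split=> [N|z z_even z_annulus EzA].
  by split=> //; apply: ghas_sum_gsummable (Pin_sum N).
move: z_annulus; rewrite !norm_normc -!fmorphV /= !ltcR -!/(Y _).
move=> /andP[z_hi z_lo].
have Y_hi_gt0 := le_lt_trans Y_lo_ge0 Y_lo_hi.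
(* Inversion sends 0 to 0, so the upper bound on |z| excludes |y_lo| = 0. *)
have Y_lo_gt0 : 0 < Y lo.
  rewrite -invr_gt0; apply: le_lt_trans z_lo; exact: normc_ge0.
have {}z_lo : normc (body z) * Y lo < 1 by rewrite -ltr_pdivlMr // mul1r.
have {}z_hi : 1 < normc (body z) * Y hi by rewrite -ltr_pdivrMr // mul1r.
have sumS : ghas_sum
    (fun N : int => z ^ N * (-1) ^ N * Str (S_op N s (Pi_op A))) (Ber EzA).
  rewrite (Ber_1DzA A_x A_y); last 2 first.
  - by move=> a; apply: (centralP _ (geven_central z_even)).
  - by move=> mu; apply: (centralP _ (geven_central z_even)).
  apply: ghas_sum_fibres (laurent_ghas_sum s_le_m x_even y_even z_even
    (annulus _ z_lo z_hi) (z_unit _ z_hi)) _ => N.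
  have termE (b : hbasis (S_superspace n m N s)) :
      laurent_term s x y z (val b) =
      z ^ N * (-1) ^ N * str_term (S_op N s (Pi_op A)) b.
    by rewrite (str_term_S A_x A_y) /laurent_term (eqP (valP b)).
  apply: (eq_ghas_sum (fun b => esym (termE b))).
  exact: (@ghas_sumZ _ _ _ (z ^ N * (-1) ^ N) _ _
    (gsummable_gsum (summable_S N))).
split; first exact: sumS.
apply: eq_ghas_sum sumS => N.
by rewrite [in RHS]/Str (ghas_sum_gsum (Pin_sum N)) mulrA.
Qed.
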